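(* Let $\mathcal R = (\Sigma, E, R)$ be a rewrite theory with a given set of strategy definitions, let $AP_\Pi$ be a set of atomic propositions with labeling function $L_\Pi : T_{\Sigma/E} \to \mathcal P(AP_\Pi)$, and let $\mathcal M$ be the Kripke structure with states $T_{\Sigma/E}$, transition relation $\to^1_R$, all states initial, and labeling $L_\Pi$. Let $\alpha$ be a strategy expression and $t$ a ground term. Let $\mathcal M_{\alpha,t}$ be the Kripke structure with state set $\mathcal{XS} \times \{0\} \cup \mathrm{Sol} \times \{1\}$, single initial state $(t \mathbin{@} \alpha, 0)$, transitions $(q,0) \to (q',0)$ whenever $q \twoheadrightarrow q'$ and $(q,k) \to (q,1)$ for all $q \in \mathrm{Sol}$ and $k \in \{0,1\}$, and labeling $(q,k) \mapsto L_\Pi(\mathrm{cterm}(q))$. Then for any linear-time property $\varphi$, $$(\mathcal M, E(\alpha, t)) \vDash \varphi \iff \mathcal M_{\alpha,t} \vDash \varphi .$$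
   Context: **Satisfaction.** A linear-time property $\varphi$ is (identified with) a set of propositional traces in $\mathcal P(AP_\Pi)^\omega$, and a trace satisfies $\varphi$ if it belongs to the set. A Kripke structure satisfies $\varphi$ if the labelings of all its infinite executions from initial states satisfy $\varphi$. For a set $F$ of executions of $\mathcal M$, $(\mathcal M,F)\vDash\varphi$ means that $L_\Pi(\pi)$ satisfies $\varphi$ for all $\pi\in F$ ($L_\Pi$ applied letterwise), where any finite execution $w_0\cdots w_n\in F$ is read as its stuttering extension $w_0\cdots w_n w_n w_n\cdots$. **Rewriting.** $\mathcal R = (\Sigma, E, R)$ is a rewrite theory over a membership equational theory $(\Sigma,E)$, with labeled rules, possibly conditional, with condition fragments that are equations, sort memberships, or rewriting conditions $l \Rightarrow p$. Terms are considered modulo $E$; $T_\Sigma$ denotes ground terms and $T_{\Sigma/E}$ their classes modulo $E$ (brackets are omitted). $t \to^1_R t'$ is one-step rewriting. **Strategy expressions.** Core grammar: $\alpha ::= \mathtt{idle} \mid \mathtt{fail} \mid \mathtt{match}\,P\,\mathtt{s.t.}\,C \mid \alpha;\alpha \mid \alpha|\alpha \mid \alpha^* \mid \alpha\,?\,\alpha:\alpha \mid \mathtt{matchrew}\,P\,\mathtt{s.t.}\,C\,\mathtt{by}\,x_1\,\mathtt{using}\,\alpha_1,\ldots,x_n\,\mathtt{using}\,\alpha_n \mid sl(t_1,\ldots,t_n) \mid \mathtt{all} \mid rl[\rho]\{\alpha_1,\ldots,\alpha_m\}$, where $C$ is an equational condition, $rl$ is a rule label, $\rho$ is an optional initial substitution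 $x_1 \leftarrow t_1,\ldots$, the list of $m\ge0$ strategies is for a rule with $m$ rewriting conditions, and $sl$ is a strategy name given by definitions $sl(p_1,\ldots,p_n) := \delta$ (optionally: if an equational condition holds), which may be mutually recursive. Rule applications may be wrapped in $\mathtt{top}(\cdot)$ to apply only at the root. (Variants $\mathtt{amatch}$, $\mathtt{amatchrew}$ match at any position; $\mathtt{xmatch}$, $\mathtt{xmatchrew}$ match with extension.) Other combinators are abbreviations. **Execution states** $\mathcal{XS}$: $q ::= t \mathbin{@} s \mid \mathrm{subterm}(x_1:q_1,\ldots,x_n:q_n;t)\mathbin{@} s \mid \mathrm{rewc}(p:q,\sigma,C,\vec\alpha,\theta,r,c;t)\mathbin{@} s$, with stacks $s ::= \varepsilon \mid \alpha s \mid \theta s$ of strategy expressions $\alpha$ and substitutions $\theta$. $\mathrm{vctx}(\theta s)=\theta$, $\mathrm{vctx}(\varepsilon)=\mathrm{id}$, $\mathrm{vctx}(\alpha s)=\mathrm{vctx}(s)$. Current term: $\mathrm{cterm}(t\mathbin{@} s)=t$, $\mathrm{cterm}(\mathrm{rewc}(\ldots;t)\mathbin{@} s)=t$, $\mathrm{cterm}(\mathrm{subterm}(x_1:q_1,\ldots,x_n:q_n;t)\mathbin{@} s)=t[x_1/\mathrm{cterm}(q_1),\ldots,x_n/\mathrm{cterm}(q_n)]$. States $t\mathbin{@}\varepsilon$ are solutions. **Transitions** ($\to_c$ control, $\to_s$ system, $\to_{s,c} = \to_s\cup\to_c$), where $\theta=\mathrm{vctx}(s)$ instantiates the variables of the expressions: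 - $t\mathbin{@}\mathtt{idle}\,s\to_c t\mathbin{@} s$; no rule for $\mathtt{fail}$; $t\mathbin{@}\theta' s\to_c t\mathbin{@} s$ (popping a substitution). - $t\mathbin{@}(\mathtt{match}\,P\,\mathtt{s.t.}\,C)\,s\to_c t\mathbin{@} s$ if $t$ matches $P$ satisfying $C$. - $t\mathbin{@}(\alpha;\beta)s\to_c t\mathbin{@}\alpha\beta s$; $t\mathbin{@}(\alpha|\beta)s\to_c t\mathbin{@}\alpha s$ and $\to_c t\mathbin{@}\beta s$; $t\mathbin{@}\alpha^* s\to_c t\mathbin{@} s$ and $\to_c t\mathbin{@}\alpha\,\alpha^* s$. - $t\mathbin{@}(\alpha?\beta:\gamma)s\to_c t\mathbin{@}\alpha\beta s$; and $t\mathbin{@}(\alpha?\beta:\gamma)s\to_c t\mathbin{@}\gamma s$ if $\to_{s,c}$ is terminating from $t\mathbin{@}\alpha\theta$ and reaches no solution from it. - $t\mathbin{@}\mathtt{all}\,s\to_s t'\mathbin{@} s$ if $t\to^1_R t'$. For a rule labeled $rl$ without rewriting conditions, $t\mathbin{@} rl[\rho]s\to_s t'\mathbin{@} s$ for each $t'$ obtained from $t$ by applying, at some position, that rule instantiated first by $\rho$ (whose terms are instantiated by $\theta$). - For a rule labeled $rl$ with right-hand side $r$ and condition $C_0\wedge l_1\Rightarrow p_1\wedge C'$ with $C_0$ equational and $m\ge1$ rewriting fragments in total: $t\mathbin{@} rl[\rho]\{\alpha_1,\ldots,\alpha_m\}s\to_c\mathrm{rewc}(p_1:\sigma(l_1)\mathbin{@}\alpha_1\theta,\sigma,C',\alpha_2\cdots\alpha_m,\theta,r,c;t)\mathbin{@}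 s$ for each context $c$ and substitution $\sigma$ (extending $\rho$) matching the left-hand side in $t$ and satisfying $C_0$. If $q\to_s q'$ or $q\to_c q'$, then $\mathrm{rewc}(p:q,\ldots)\mathbin{@} s\to_c\mathrm{rewc}(p:q',\ldots)\mathbin{@} s$. For each $\sigma'$ extending $\sigma$ with $\sigma'(p)=t'$ and satisfying the equational condition $C_0$: $\mathrm{rewc}(p:t'\mathbin{@}\varepsilon,\sigma,C_0\wedge l\Rightarrow p'\wedge C,\alpha\vec\alpha,\theta,r,c;t)\mathbin{@} s\to_c\mathrm{rewc}(p':\sigma'(l)\mathbin{@}\alpha\theta,\sigma',C,\vec\alpha,\theta,r,c;t)\mathbin{@} s$, and, when no rewriting fragment remains, $\mathrm{rewc}(p:t'\mathbin{@}\varepsilon,\sigma,C_0,\ldots,r,c;t)\mathbin{@} s\to_s c(\sigma'(r))\mathbin{@} s$. - $t\mathbin{@}(\mathtt{matchrew}\,P\,\mathtt{s.t.}\,C\,\mathtt{by}\,x_1\,\mathtt{using}\,\alpha_1,\ldots)s\to_c\mathrm{subterm}(x_1:\sigma(x_1)\mathbin{@}\alpha_1\sigma,\ldots,x_n:\sigma(x_n)\mathbin{@}\alpha_n\sigma;\sigma_{-\{x_1,\ldots,x_n\}}(P))\mathbin{@} s$ for each match $\sigma$ of $t$ with $P$ satisfying $C$ and extending $\theta$ ($\sigma_{-X}$ leaves the variables in $X$ untouched). If $q_i\to_\bullet q_i'$ with $\bullet\in\{s,c\}$, then $\mathrm{subterm}(\ldots,x_i:q_i,\ldots;t)\mathbin{@}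 s\to_\bullet\mathrm{subterm}(\ldots,x_i:q_i',\ldots;t)\mathbin{@} s$. $\mathrm{subterm}(x_1:t_1\mathbin{@}\varepsilon,\ldots,x_n:t_n\mathbin{@}\varepsilon;t)\mathbin{@} s\to_c t[x_1/t_1,\ldots,x_n/t_n]\mathbin{@} s$. - $t\mathbin{@} sl(t_1,\ldots,t_n)s\to_c t\mathbin{@}\delta\sigma s$ for every definition whose left-hand side matches the call instantiated by $\theta$, with substitution $\sigma$ (and condition satisfied), $\delta$ being its right-hand side; if the top of $s$ is a substitution, it is replaced by $\sigma$ (tail call). Control steps preserve $\mathrm{cterm}$, and system steps project to $\to^1_R$ steps. **Denotation.** $\twoheadrightarrow$ is $\to_c^*$ followed by one $\to_s$. $\mathrm{Ex}^*(\alpha,t)=\{q_0\cdots q_n: q_0=t\mathbin{@}\alpha,\ q_k\twoheadrightarrow q_{k+1},\ q_n\to_c^* t'\mathbin{@}\varepsilon \text{ for some } t'\in T_\Sigma\}$, $\mathrm{Ex}^\omega(\alpha,t)=\{(q_k)_{k\ge0}: q_0=t\mathbin{@}\alpha,\ q_k\twoheadrightarrow q_{k+1}\}$, and $E(\alpha,t)=\mathrm{cterm}(\mathrm{Ex}^*(\alpha,t)\cup\mathrm{Ex}^\omega(\alpha,t))$ (cterm applied letterwise). $\mathrm{Sol}=\{q\in\mathcal{XS}: q\to_c^*\mathrm{cterm}(q)\mathbin{@}\varepsilon\}$. *)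

(* Defs.v *)
From HB Require Import structures.
From mathcomp Require Import all_boot.
From mathcomp Require Import boolp classical_sets.
From Stdlib Require List Operators_Properties.
From Stdlib Require Import Relation_Operators.

Set Implicit Arguments.
Unset Strict Implicit.
Unset Printing Implicit Defensive.

Local Open Scope quotient_scope.
Local Open Scope classical_set_scope.

(** * Membership equational logic *)

Record signature := Signature {
  kind : eqType;
  op : Type;
  arity : op -> nat;
  dom : forall f : op, 'I_(arity f) -> kind;
  cod : op -> kind;
  msort : kind -> Type
}.

Section Terms.
Variable S : signature.

Inductive term (W : kind S -> Type) : kind S -> Type :=
| Var k (w : W k) : term W k
| App f (a : forall i, term W (dom (f := f) i)) : term W (cod f).

Definition gterm : kind S -> Type := term (fun _ => Empty_set).

(** The variables of the patterns in the equations, rules and strategies are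
    the pairs [(k, x)], with [k] a kind and [x] a natural number. *)
Definition pterm : kind S -> Type := term (fun _ => nat).

Fixpoint eval (W A : kind S -> Type)
    (opA : forall f : op S, (forall i, A (dom (f := f) i)) -> A (cod f))
    (v : forall k, W k -> A k) k (t : term W k) : A k :=
  match t with
  | Var _ w => v _ w
  | App f a => opA f (fun i => eval opA v (a i))
  end.

(** Substitutions are partial, and the variables outside their domain are left
    as they are.  [inst opA g P a] says that all the variables of [P] are in
    the domain of [g] and that [P] instantiated by [g] has value [a].  It is
    not a function like [eval] because some kinds may be empty.  The valuation
    is given by its graph. *)
Inductive inst (A : kind S -> Type)
    (opA : forall f : op S, (forall i, A (dom (f := f) i)) -> A (cod f))
    (g : forall k, nat -> A k -> Prop) : forall k, pterm k -> A k -> Prop :=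
| InstVar k x a : g k x a -> inst opA g (Var x : pterm k) a
| InstApp f (P : forall i, pterm (dom (f := f) i)) a :
    (forall i, inst opA g (P i) (a i)) -> inst opA g (App P) (opA f a).

Definition subst (A : kind S -> Type) := forall k, nat -> option (A k).

Definition graph A (th : subst A) k x (a : A k) := th k x = Some a.

Fixpoint occurs k0 (x0 : nat) k (P : pterm k) : Prop :=
  match P with
  | Var k x => k = k0 /\ x = x0
  | App f a => exists i, occurs k0 x0 (a i)
  end.

Definition top_op W k (P : term W k) : option (op S) :=
  if P is App f _ then Some f else None.

(** Atomic equational sentences, [u = v] and [u : s]; matching conditions
    [p := u] are equations. *)
Inductive eqfrag :=
| EqF (k : kind S) (u v : pterm k)
| MemF (k : kind S) (u : pterm k) (s : msort k).

Definition eqcond := seq eqfrag.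

Definition occurs_eqfrag k0 x0 (c : eqfrag) : Prop :=
  match c with
  | EqF _ u v => occurs k0 x0 u \/ occurs k0 x0 v
  | MemF _ u _ => occurs k0 x0 u
  end.

Definition occurs_eqcond k0 x0 (C : eqcond) : Prop :=
  exists2 c, List.In c C & occurs_eqfrag k0 x0 c.

End Terms.

Arguments gterm {S} k.
Arguments pterm {S} k.

HB.instance Definition _ S W k := gen_eqMixin (@term S W k).
HB.instance Definition _ S W k := gen_choiceMixin (@term S W k).

(** [axioms c C] means that the sentence [c if C] belongs to [E]. *)
Record eqtheory := EqTheory {
  esig :> signature;
  axioms : eqfrag esig -> eqcond esig -> Prop
}.

Section EqDeduction.
Variable T : eqtheory.

Definition gapp (f : op T) (a : forall i, gterm (dom (f := f) i)) :
  gterm (cod f) := App a.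

Local Notation ginst th := (inst gapp (graph th)).

Inductive eqE : forall k, gterm k -> gterm k -> Prop :=
| EqRefl k (t : gterm k) : eqE t t
| EqSym k (t u : gterm k) : eqE t u -> eqE u t
| EqTrans k (t u v : gterm k) : eqE t u -> eqE u v -> eqE t v
| EqCong f (a b : forall i, gterm (dom (f := f) i)) :
    (forall i, eqE (a i) (b i)) -> eqE (gapp a) (gapp b)
| EqAx k (P Q : pterm k) C (th : subst gterm) (t u : gterm k) :
    axioms (EqF P Q) C -> (forall c, List.In c C -> holdsG th c) ->
    ginst th P t -> ginst th Q u -> eqE t u
with memE : forall k, gterm k -> msort k -> Prop :=
| MemEq k (t u : gterm k) s : eqE t u -> memE t s -> memE u s
| MemAx k (P : pterm k) s C (th : subst gterm) (t : gterm k) :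
    axioms (MemF P s) C -> (forall c, List.In c C -> holdsG th c) ->
    ginst th P t -> memE t s
with holdsG : subst gterm -> eqfrag T -> Prop :=
| HoldsEq th k (P Q : pterm k) (t u : gterm k) :
    ginst th P t -> ginst th Q u -> eqE t u -> holdsG th (EqF P Q)
| HoldsMem th k (P : pterm k) s (t : gterm k) :
    ginst th P t -> memE t s -> holdsG th (MemF P s).

Definition eqEb k : rel (gterm k) := fun t u => `[< eqE t u >].

Lemma eqEb_refl k : reflexive (@eqEb k).
Proof. by move=> t; apply/asboolP; apply: EqRefl. Qed.

Lemma eqEb_sym k : symmetric (@eqEb k).
Proof. by move=> t u; apply/asboolP/asboolP => /EqSym. Qed.

Lemma eqEb_trans k : transitive (@eqEb k).
Proof.
by move=> t u v /asboolP ut /asboolP tv; apply/asboolP; apply: EqTrans ut tv.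
Qed.

Canonical eqE_equiv k :=
  EquivRel (@eqEb k) (@eqEb_refl k) (@eqEb_sym k) (@eqEb_trans k).

(** The component of kind [k] of the algebra of ground terms modulo [E]. *)
Definition cterms k : Type := {eq_quot (@eqEb k)}.

Definition class k (t : gterm k) : cterms k := \pi_({eq_quot (@eqEb k)}) t.

Definition rep k (t : cterms k) : gterm k := repr (t : {eq_quot (@eqEb k)}).

Definition qapp (f : op T) (a : forall i, cterms (dom (f := f) i)) :
  cterms (cod f) := class (gapp (fun i => rep (a i))).

Definition memq k (t : cterms k) (s : msort k) : Prop := memE (rep t) s.

(** [psubst] is the type of the substitutions of the strategy semantics. *)
Definition psubst := subst cterms.

Definition idsub : psubst := fun _ _ => None.

Definition qinst (th : psubst) k (P : pterm k) (t : cterms k) : Prop :=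
  inst qapp (graph th) P t.

Definition holds1 (th : psubst) (c : eqfrag T) : Prop :=
  match c with
  | EqF k P Q => exists2 t, qinst th P t & qinst th Q t
  | MemF k P s => exists2 t, qinst th P t & memq t s
  end.

Definition holds (th : psubst) (C : eqcond T) : Prop :=
  forall c, List.In c C -> holds1 th c.

Definition extends (th th' : psubst) : Prop :=
  forall k x t, th k x = Some t -> th' k x = Some t.

(** [th'] extends [th] to the variables in [D] and to no other one. *)
Definition binds (D : kind T -> nat -> Prop) (th th' : psubst) : Prop :=
  extends th th' /\
  forall k x, th' k x <> None <-> th k x <> None \/ D k x.

(** Contexts with a single hole of kind [k0], modulo [E] in the arguments
    outside the path to the hole. *)
Inductive ctx (k0 : kind T) : kind T -> Type :=
| Hole : ctx k0 k0
| CApp f (a : forall i, cterms (dom (f := f) i)) (i : 'I_(arity f))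
    (c : ctx k0 (dom i)) : ctx k0 (cod f).

Definition is_hole k0 k (c : ctx k0 k) : Prop :=
  if c is Hole then True else False.

Fixpoint all_ops (F : op T -> Prop) k0 k (c : ctx k0 k) : Prop :=
  if c is CApp f _ _ c' then F f /\ all_ops F c' else True.

Fixpoint plugin (A : kind T -> Type)
    (opA : forall f : op T, (forall i, A (dom (f := f) i)) -> A (cod f))
    (emb : forall k, cterms k -> A k) k0 k (c : ctx k0 k) (t : A k0) : A k :=
  match c with
  | Hole => t
  | CApp f a i c' =>
      opA f (dfwith (fun j => emb _ (a j)) (plugin opA emb c' t))
  end.

Definition plug k0 k (c : ctx k0 k) (t : cterms k0) : cterms k :=
  plugin qapp (fun _ u => u) c t.

(** [bin f t u v] says that [f] is binary and [v = f(t, u)]. *)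
Inductive bin (f : op T) : forall k k' k'', cterms k -> cterms k' ->
    cterms k'' -> Prop :=
| Bin (a : forall i, cterms (dom (f := f) i)) (i j : 'I_(arity f)) :
    arity f = 2 -> i = 0 :> nat -> j = 1 :> nat ->
    bin f (a i) (a j) (qapp a).

Definition associative_op (f : op T) : Prop :=
  [/\ arity f = 2, forall i, dom (f := f) i = cod f &
   forall t u v tu uv l r : cterms (cod f),
     bin f t u tu -> bin f tu v l -> bin f u v uv -> bin f t uv r -> l = r].

End EqDeduction.

Arguments qapp {T f} a.
Arguments idsub {T}.
Arguments Hole {T k0}.

(** * Rewrite theories *)

Inductive rfrag (S : signature) :=
| EqFrag (c : eqfrag S)
| RewFrag (k : kind S) (l p : pterm k).

Definition rcond (S : signature) := seq (rfrag S).

Definition eqpart (S : signature) (C : eqcond S) : rcond S :=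
  [seq EqFrag c | c <- C].

Record rule (S : signature) (L : Type) := Rule {
  rlabel : L;
  rkind : kind S;
  lhs : pterm rkind;
  rhs : pterm rkind;
  cond : rcond S
}.

(** [assoc] gives the operators declared as associative, which are those for
    which matching with extension is meaningful. *)
Record rewtheory := RewTheory {
  reqs :> eqtheory;
  assoc : op reqs -> Prop;
  assocP : forall f, assoc f -> associative_op f;
  label : Type;
  rules : rule reqs label -> Prop
}.

Section Rewriting.
Variable R : rewtheory.

(** One-step rewriting modulo [E], restricted to the root when the Boolean is
    [true]. *)
Inductive rew : bool -> forall k, cterms (T := R) k -> cterms k -> Prop :=
| Rew (top : bool) (rl : rule R (label R)) (th : psubst R) k
    (c : ctx (rkind rl) k) t u :
    rules rl -> (top -> is_hole c) ->
    (forall d, List.In d (cond rl) -> rholds th d) ->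
    qinst th (lhs rl) t -> qinst th (rhs rl) u ->
    rew top (plug c t) (plug c u)
with rholds : psubst R -> rfrag R -> Prop :=
| RHoldsEq th c : holds1 th c -> rholds th (EqFrag c)
| RHoldsRew th k (l p : pterm k) t u :
    qinst th l t -> qinst th p u -> rews t u -> rholds th (RewFrag l p)
with rews : forall k, cterms (T := R) k -> cterms k -> Prop :=
| RewsRefl k (t : cterms k) : rews t t
| RewsStep k (t u v : cterms k) : rew false t u -> rews u v -> rews t v.

End Rewriting.

(** * The strategy language *)

(** [Root] is for [match] and [matchrew], [Anywhere] for [amatch] and
    [amatchrew], and [Ext] for [xmatch] and [xmatchrew]. *)
Inductive mmode := Root | Anywhere | Ext.

Section Strategies.
Variables (R : rewtheory) (SL : Type).

Definition anyterm := {k : kind R & pterm k}.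

(** The Boolean of [All] and [RuleApp] says whether they are wrapped
    in [top]. *)
Inductive strat :=
| Idle
| Fail
| Match (m : mmode) (k : kind R) (P : pterm k) (C : eqcond R)
| Conc (a b : strat)
| Alt (a b : strat)
| Star (a : strat)
| Cond (a b c : strat)
| MatchRew (m : mmode) (k : kind R) (P : pterm k) (C : eqcond R)
    n (xs : 'I_n.+1 -> kind R * nat) (al : 'I_n.+1 -> strat)
| Call (sl : SL) (args : seq anyterm)
| All (top : bool)
| RuleApp (top : bool) (l : label R)
    (rho : seq {k : kind R & (nat * pterm k)%type}) (al : seq strat).

(** The definition [sdname(sdparams) := sdbody] if [sdcond]. *)
Record sdef := SDef {
  sdname : SL;
  sdparams : seq anyterm;
  sdbody : strat;
  sdcond : eqcond R
}.

Inductive frame :=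
| FStrat (a : strat)
| FSubst (th : psubst R).

Definition stack := seq frame.

Fixpoint vctx (s : stack) : psubst R :=
  match s with
  | [::] => idsub
  | FStrat _ :: s' => vctx s'
  | FSubst th :: _ => th
  end.

(** A tail call forgets the substitution on top of the stack, if any. *)
Definition poptop (s : stack) : stack :=
  if s is FSubst _ :: s' then s' else s.

(** [Slot i] stands for the variable [xs i] in the term of a [subterm] state,
    whose other leaves are (classes of) ground terms. *)
Inductive slot n (xs : 'I_n -> kind R * nat) : kind R -> Type :=
| Slot i : slot xs (xs i).1.

Definition holeterm n (xs : 'I_n -> kind R * nat) : kind R -> Type :=
  term (fun k => cterms k + slot xs k)%type.

Definition happ n (xs : 'I_n -> kind R * nat) (f : op R)
  (a : forall i, holeterm xs (dom (f := f) i)) : holeterm xs (cod f) := App a.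

Definition hconst n (xs : 'I_n -> kind R * nat) k (t : cterms (T := R) k) :
  holeterm xs k := Var (inl t).

Definition hslot n (xs : 'I_n -> kind R * nat) (i : 'I_n) :
  holeterm xs (xs i).1 := Var (inr (Slot xs i)).

Definition hplug n (xs : 'I_n -> kind R * nat) k0 k (c : ctx k0 k)
  (u : holeterm xs k0) : holeterm xs k := plugin (@happ n xs) (@hconst n xs) c u.

(** The substitution [th] minus the variables in [xs], which are kept.  A
    repeated variable stands for its first occurrence. *)
Inductive keep (th : psubst R) n (xs : 'I_n -> kind R * nat) :
    forall k, nat -> holeterm xs k -> Prop :=
| KeepIn (i : 'I_n) : (forall j : 'I_n, j < i -> xs j != xs i) ->
    keep th (xs i).2 (hslot xs i)
| KeepOut k x t : (forall i, xs i != (k, x)) -> th k x = Some t ->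
    keep th x (hconst xs t).

(** [u] is [P] instantiated by [th] minus the variables in [xs]. *)
Definition inst_but (th : psubst R) n (xs : 'I_n -> kind R * nat) k
    (P : pterm k) (u : holeterm xs k) : Prop :=
  inst (@happ n xs) (@keep th n xs) P u.

Definition slotval n (xs : 'I_n -> kind R * nat)
    (ts : forall i, cterms (T := R) (xs i).1) k (w : cterms k + slot xs k) :
  cterms k :=
  match w with
  | inl t => t
  | inr s => match s in slot _ k' return cterms k' with Slot i => ts i end
  end.

(** [u] with [ts i] in the place of [xs i]. *)
Definition fill n (xs : 'I_n -> kind R * nat)
    (ts : forall i, cterms (T := R) (xs i).1) k (u : holeterm xs k) :
  cterms k := eval (@qapp R) (slotval ts) u.

(** Execution states, indexed by the kind of their current terms. *)
Inductive state : kind R -> Type :=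
| At k (t : cterms (T := R) k) (s : stack) : state k
| Subterm k n (xs : 'I_n.+1 -> kind R * nat) (qs : forall i, state (xs i).1)
    (u : holeterm xs k) (s : stack) : state k
| Rewc (k k0 k1 : kind R) (p : pterm k1) (q : state k1) (sg : psubst R)
    (C : rcond R) (al : seq strat) (th : psubst R) (r : pterm k0)
    (c : ctx k0 k) (t : cterms k) (s : stack) : state k.

Fixpoint cterm k (q : state k) : cterms k :=
  match q with
  | At _ t _ => t
  | Subterm _ _ _ qs u _ => fill (fun i => cterm (qs i)) u
  | Rewc _ _ _ _ _ _ _ _ _ _ _ t _ => t
  end.

(** ** Matching *)

Definition mode_ctx (m : mmode) (k0 : kind R) (P : pterm k0) k (c : ctx k0 k) :
  Prop :=
  match m with
  | Root => is_hole c
  | Anywhere => True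
  (* every context inside a flattened [f(t_1, ..., t_n)] can be written, by
     associativity, with a chain of occurrences of [f] *)
  | Ext => all_ops (fun f => top_op P = Some f /\ assoc f) c
  end.

(** [sg] extends [th] to the variables of [P] and [C] so that [t] is [P]
    instantiated by [sg] within the context [c]. *)
Definition matches (m : mmode) (k0 : kind R) (P : pterm k0) (C : eqcond R)
    (th : psubst R) k (t : cterms k) (c : ctx k0 k) (sg : psubst R) : Prop :=
  [/\ mode_ctx m P c,
      binds (fun k x => occurs k x P \/ occurs_eqcond k x C) th sg,
      holds sg C &
      exists2 t0, qinst sg P t0 & t = plug c t0].

(** [sg] is the initial substitution [rho] with its terms instantiated
    by [th]. *)
Definition initial_subst (th : psubst R)
    (rho : seq {k : kind R & (nat * pterm k)%type}) (sg : psubst R) :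
  Prop :=
  (forall k x P, List.In (existT _ k (x, P)) rho -> exists t, qinst th P t) /\
  forall k x t, sg k x = Some t <->
    exists2 P, List.In (existT _ k (x, P)) rho & qinst th P t.

(** The arguments [args] instantiated by [th] match the parameters [params]
    with substitution [sg]. *)
Definition match_args (th : psubst R) (args params : seq anyterm)
    (sg : psubst R) : Prop :=
  List.Forall2 (fun a p => exists k (P Q : pterm k) t,
    [/\ a = existT _ k P, p = existT _ k Q, qinst th P t & qinst sg Q t])
    args params.

Definition occurs_params k x (params : seq anyterm) : Prop :=
  exists2 p, List.In p params & occurs k x (projT2 p).

(** ** Transitions *)

(** Tells the system steps from the control steps. *)
Inductive stepkind := Sys | Ctl.

Definition oracle := forall k, cterms (T := R) k -> strat -> psubst R -> Prop.

Variable D : sdef -> Prop.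

Section Step.
(** [X k t a th] stands for the failure of [a] on [t] with [th], which is the
    negative premise of the conditional. *)
Variable X : oracle.

Inductive step : stepkind -> forall k, state k -> state k -> Prop :=
| StIdle k (t : cterms k) s :
    step Ctl (At t (FStrat Idle :: s)) (At t s)
| StPop k (t : cterms k) th s :
    step Ctl (At t (FSubst th :: s)) (At t s)
| StMatch k (t : cterms k) m k0 (P : pterm k0) C s c sg :
    matches m P C (vctx s) t c sg ->
    step Ctl (At t (FStrat (Match m P C) :: s)) (At t s)
| StConc k (t : cterms k) a b s :
    step Ctl (At t (FStrat (Conc a b) :: s))
             (At t (FStrat a :: FStrat b :: s))
| StAltL k (t : cterms k) a b s :
    step Ctl (At t (FStrat (Alt a b) :: s)) (At t (FStrat a :: s))
| StAltR k (t : cterms k) a b s :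
    step Ctl (At t (FStrat (Alt a b) :: s)) (At t (FStrat b :: s))
| StStarEnd k (t : cterms k) a s :
    step Ctl (At t (FStrat (Star a) :: s)) (At t s)
| StStarGo k (t : cterms k) a s :
    step Ctl (At t (FStrat (Star a) :: s))
             (At t (FStrat a :: FStrat (Star a) :: s))
| StCondThen k (t : cterms k) a b c s :
    step Ctl (At t (FStrat (Cond a b c) :: s))
             (At t (FStrat a :: FStrat b :: s))
| StCondElse k (t : cterms k) a b c s :
    X t a (vctx s) ->
    step Ctl (At t (FStrat (Cond a b c) :: s)) (At t (FStrat c :: s))
| StAll k (t u : cterms k) (top : bool) s :
    rew top t u -> step Sys (At t (FStrat (All top) :: s)) (At u s)
| StRule k (top : bool) l rho s (rl : rule R (label R)) C0 sg0 sg
    (c : ctx (rkind rl) k) t0 u0 :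
    rules rl -> rlabel rl = l -> cond rl = eqpart C0 ->
    initial_subst (vctx s) rho sg0 -> extends sg0 sg ->
    (top -> is_hole c) -> holds sg C0 ->
    qinst sg (lhs rl) t0 -> qinst sg (rhs rl) u0 ->
    step Sys (At (plug c t0) (FStrat (RuleApp top l rho [::]) :: s))
             (At (plug c u0) s)
| StRewcStart k (top : bool) l rho a al s (rl : rule R (label R))
    C0 k1 (l1 p1 : pterm k1) C' sg0 sg (c : ctx (rkind rl) k) t0 t1 :
    rules rl -> rlabel rl = l ->
    cond rl = eqpart C0 ++ RewFrag l1 p1 :: C' ->
    count (fun d => if d is RewFrag _ _ _ then true else false) C' = size al ->
    initial_subst (vctx s) rho sg0 ->
    binds (fun k x => [\/ occurs k x (lhs rl), occurs_eqcond k x C0 |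
                          occurs k x l1]) sg0 sg ->
    (top -> is_hole c) -> holds sg C0 ->
    qinst sg (lhs rl) t0 -> qinst sg l1 t1 ->
    step Ctl (At (plug c t0) (FStrat (RuleApp top l rho (a :: al)) :: s))
             (Rewc p1 (At t1 [:: FStrat a; FSubst (vctx s)]) sg C' al (vctx s)
                   (rhs rl) c (plug c t0) s)
| StRewcIn b k k0 k1 (p : pterm k1) (q q' : state k1) sg C al th
    (r : pterm k0) (c : ctx k0 k) t s :
    step b q q' ->
    step Ctl (Rewc p q sg C al th r c t s) (Rewc p q' sg C al th r c t s)
| StRewcNext k k0 k1 (p : pterm k1) t' sg C0 k2 (l2 p2 : pterm k2) C a al th
    (r : pterm k0) (c : ctx k0 k) t s sg' t2 :
    binds (fun k x => [\/ occurs k x p, occurs_eqcond k x C0 |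
                          occurs k x l2]) sg sg' ->
    qinst sg' p t' -> holds sg' C0 -> qinst sg' l2 t2 ->
    step Ctl
      (Rewc p (At t' [::]) sg (eqpart C0 ++ RewFrag l2 p2 :: C) (a :: al) th
            r c t s)
      (Rewc p2 (At t2 [:: FStrat a; FSubst th]) sg' C al th r c t s)
| StRewcEnd k k0 k1 (p : pterm k1) t' sg C0 al th (r : pterm k0) (c : ctx k0 k)
    t s sg' u0 :
    extends sg sg' -> qinst sg' p t' -> holds sg' C0 -> qinst sg' r u0 ->
    step Sys (Rewc p (At t' [::]) sg (eqpart C0) al th r c t s)
             (At (plug c u0) s)
| StMatchRew k (t : cterms k) m k0 (P : pterm k0) C n
    (xs : 'I_n.+1 -> kind R * nat) al s (c : ctx k0 k) sg ts u :
    matches m P C (vctx s) t c sg ->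
    (forall i, sg (xs i).1 (xs i).2 = Some (ts i)) -> inst_but sg P u ->
    step Ctl (At t (FStrat (MatchRew m P C xs al) :: s))
             (@Subterm k n xs
                (fun i => At (ts i) [:: FStrat (al i); FSubst sg])
                (hplug c u) s)
| StSubtermIn b k n (xs : 'I_n.+1 -> kind R * nat)
    (qs : forall i, state (xs i).1) (u : holeterm xs k) s i q' :
    step b (qs i) q' ->
    step b (Subterm qs u s) (Subterm (dfwith qs q') u s)
| StSubtermEnd k n (xs : 'I_n.+1 -> kind R * nat)
    (qs : forall i, state (xs i).1) (u : holeterm xs k) s ts :
    (forall i, qs i = At (ts i) [::]) ->
    step Ctl (Subterm qs u s) (At (fill ts u) s)
| StCall k (t : cterms k) sl args s d sg :
    D d -> sdname d = sl ->
    binds (fun k x => occurs_params k x (sdparams d) \/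
                      occurs_eqcond k x (sdcond d)) idsub sg ->
    match_args (vctx s) args (sdparams d) sg -> holds sg (sdcond d) ->
    step Ctl (At t (FStrat (Call sl args) :: s))
             (At t (FStrat (sdbody d) :: FSubst sg :: poptop s)).

Definition anystep k (q q' : state k) : Prop := exists b, step b q q'.

(** [anystep] is terminating from [t @ a th], where it reaches no solution. *)
Definition finitely_fails : oracle := fun k t a th =>
  let q0 := At t [:: FStrat a; FSubst th] in
  Acc (fun q' q : state k => anystep q q') q0 /\
  ~ exists t', clos_refl_trans _ (@anystep k) q0 (At t' [::]).

End Step.

(** The conditional makes the transitions depend negatively on themselves, by
    means of [finitely_fails].  This operator being antitone, its square has a
    least fixed point, [fails].  [failsE] shows that it is a fixed point of
    [finitely_fails] itself, and [fails_unique] that there is no other one. *)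
Definition fails : oracle := fun k t a th =>
  forall X : oracle,
    (forall k (t : cterms k) a th,
       finitely_fails (finitely_fails X) t a th -> X k t a th) ->
    X k t a th.

Lemma step_mono (X Y : oracle) :
  (forall k (t : cterms k) a th, X k t a th -> Y k t a th) ->
  forall b k (q q' : state k), step X b q q' -> step Y b q q'.
Proof.
move=> XY b k q q'; elim=> *; try by econstructor; eauto.
Qed.

Lemma clos_rt_mono (A : Type) (r r' : A -> A -> Prop) x y :
  (forall x y, r x y -> r' x y) ->
  clos_refl_trans A r x y -> clos_refl_trans A r' x y.
Proof.
move=> rr'; elim=> [{}x {}y /rr'|{}x|{}x {}y z _ xy _ yz];
  [exact: rt_step|exact: rt_refl|exact: rt_trans xy yz].
Qed.

Lemma finitely_fails_anti (X Y : oracle) :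
  (forall k (t : cterms k) a th, X k t a th -> Y k t a th) ->
  forall k (t : cterms k) a th,
    finitely_fails Y t a th -> finitely_fails X t a th.
Proof.
move=> XY k t a th [accY solY].
have sub (q q' : state k) : anystep X q q' -> anystep Y q q'.
  by case=> b qq'; exists b; apply: step_mono XY _ _ _ _ qq'.
split; last first.
  by case=> t' Xt'; apply: solY; exists t'; apply: clos_rt_mono sub Xt'.
by elim: accY => q _ IH; constructor=> q' /sub; apply: IH.
Qed.

Lemma fails_fix2 k (t : cterms k) a th :
  fails t a th <-> finitely_fails (finitely_fails fails) t a th.
Proof.
have pre k' (t' : cterms k') a' th' :
    finitely_fails (finitely_fails fails) t' a' th' -> fails t' a' th'.
  move=> ft' X preX; apply: (preX); move: ft'.
  apply: finitely_fails_anti; apply: finitely_fails_anti.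
  by move=> k1 t1 a1 th1 /(_ X preX).
split=> [/(_ (finitely_fails (finitely_fails fails)))|]; last exact: pre.
apply=> k' t' a' th'; apply: finitely_fails_anti; apply: finitely_fails_anti.
exact: pre.
Qed.

Section FailsFix.

Let T := {k : kind R & state k}.
Let mk k (q : state k) : T := existT _ k q.
Let G : oracle := @finitely_fails fails.

Let stepT (x x' : T) : Prop :=
  exists b (q' : state (projT1 x)), step fails b (projT2 x) q' /\ x' = mk q'.

Let rtT := clos_refl_trans T stepT.

Let stack_of k (q : state k) : stack :=
  match q with
  | At _ _ s => s
  | Subterm _ _ _ _ _ s => s
  | Rewc _ _ _ _ _ _ _ _ _ _ _ _ s => s
  end.

Let set_stack k (q : state k) (v : stack) : state k :=
  match q in state k' return state k' with
  | At _ t _ => At t v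
  | Subterm _ _ _ qs u _ => Subterm qs u v
  | Rewc _ _ _ p q sg C al th r c t _ => Rewc p q sg C al th r c t v
  end.

Let final (x : T) : Prop :=
  if projT2 x is At _ _ [::] then True else False.

(* [stk u v]: the run from a state with stack [u = a th] is simulated by the
   run with stack [v = a b s], where [th = vctx s] *)
Let stk (u v : stack) : Prop := exists b s,
  [\/ exists w, u = w ++ [:: FSubst (vctx s)] /\ v = w ++ FStrat b :: s,
      exists w th, u = w ++ [:: FSubst th] /\
                   v = w ++ FSubst th :: FStrat b :: s |
      u = [::] /\ v = FStrat b :: s].

Let stk_frame f u v : stk u v -> u <> [::] -> stk (f :: u) (f :: v).
Proof.
case=> b [s [[w [-> ->]]|[w [th [-> ->]]]|[-> //]]] _; exists b, s.
- by apply: Or31; exists (f :: w).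
- by apply: Or32; exists (f :: w), th.
Qed.

Let stk_frame2 f f' u v :
  stk u v -> u <> [::] -> stk [:: f, f' & u] [:: f, f' & v].
Proof. by move=> uv u0; apply: stk_frame => //; apply: stk_frame. Qed.

Let stk_vctx u v : stk u v -> u <> [::] -> vctx u = vctx v.
Proof.
case=> b [s [[w [-> ->]]|[w [th [-> ->]]]|[-> //]]] _.
- by elim: w => [//|[]].
- by elim: w => [//|[]].
Qed.

Let stk_strat a u v : stk (FStrat a :: u) v ->
  exists v0, [/\ v = FStrat a :: v0, stk u v0 & u <> [::]].
Proof.
case=> b [s [[[|f w] [//= [-> ->] ->]]|[[|f w] [th [//= [-> ->] ->]]]|[]//]].
- exists (w ++ FStrat b :: s); split=> //; last by case: w.
  by exists b, s; apply: Or31; exists w.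
- exists (w ++ FSubst th :: FStrat b :: s); split=> //; last by case: w.
  by exists b, s; apply: Or32; exists w, th.
Qed.

Let stk_pop th u v : stk (FSubst th :: u) v ->
  u = [::] \/ exists v0, v = FSubst th :: v0 /\ stk u v0.
Proof.
case=> b [s [[[|f w] [//= [-> ->] ->]]|[[|f w] [th' [//= [-> ->] ->]]]|[]//]].
- by left.
- by right; exists (w ++ FStrat b :: s); split=> //; exists b, s; apply: Or31; exists w.
- by left.
- right; exists (w ++ FSubst th' :: FStrat b :: s); split=> //.
  by exists b, s; apply: Or32; exists w, th'.
Qed.

Let stk_call a sg u v : stk u v -> u <> [::] ->
  stk [:: FStrat a, FSubst sg & poptop u] [:: FStrat a, FSubst sg & poptop v].
Proof.
case=> b [s [[w [-> ->]]|[w [th [-> ->]]]|[-> //]]] _; exists b, s.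
- case: w => [|[a'|th'] w] /=.
  + by apply: Or32; exists [:: FStrat a], sg.
  + by apply: Or31; exists [:: FStrat a, FSubst sg, FStrat a' & w].
  + by apply: Or31; exists [:: FStrat a, FSubst sg & w].
- case: w => [|[a'|th'] w] /=.
  + by apply: Or32; exists [:: FStrat a], sg.
  + by apply: Or32; exists [:: FStrat a, FSubst sg, FStrat a' & w], th.
  + by apply: Or32; exists [:: FStrat a, FSubst sg & w], th.
Qed.

Let step_stk b k (q q' : state k) v : step fails b q q' ->
  stk (stack_of q) v ->
  final (mk q') \/
  exists v', stk (stack_of q') v' /\
    step fails b (set_stack q v) (set_stack q' v').
Proof.
case=> /=.
all: intros.
all: try match goal with
  | H : stk (FStrat _ :: _) _ |- _ =>
    have [v0 [-> uv uN]] := stk_strat H; have vE := stk_vctx uv uN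
  end.
all: try match goal with
  | H : stk (FSubst _ :: _) _ |- _ =>
    have [->|[v0 [-> uv]]] := stk_pop H; [by left|]
  end.
all: right.
all: try by exists v; split=> //; econstructor; eauto.
all: try (repeat match goal with
  | vE : vctx ?s = vctx ?v, H : ?P |- _ =>
    lazymatch P with
    | vctx _ = vctx _ => fail
    | context [vctx s] => rewrite vE in H
    end
  end; rewrite ?vE).
all: try (eexists; split; last first;
  [by econstructor; eauto|by rewrite /=; auto using stk_frame, stk_frame2, stk_call]).
Qed.

(* the states whose runs are simulated by those of another state *)
Inductive simulates1 : T -> T -> Prop :=
| SubSubterm k n (xs : 'I_n.+1 -> kind R * nat) qs (u : holeterm xs k) s i :
    simulates1 (mk (qs i)) (mk (Subterm qs u s))
| SubRewc k k0 k1 (p : pterm k1) (q : state k1) sg C al th (r : pterm k0)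
    (c : ctx k0 k) t s :
    simulates1 (mk q) (mk (Rewc p q sg C al th r c t s))
| SubStack k (q : state k) v :
    stk (stack_of q) v -> simulates1 (mk q) (mk (set_stack q v)).

Let sub := clos_refl_trans_1n T simulates1.

Let sub1_step x x' y : simulates1 x y -> stepT x x' ->
  final x' \/ exists2 y', stepT y y' & simulates1 x' y'.
Proof.
case=> [k n xs qs u s i|k k0 k1 p q sg C al th r c t s|k q v qv]
  [b [/= q' [qq' ->]]].
- right; exists (mk (Subterm (dfwith qs q') u s)).
    by exists b, (Subterm (dfwith qs q') u s); split=> //; apply: StSubtermIn.
  by rewrite -{1}[q'](dfwith_in qs); apply: SubSubterm.
- right; exists (mk (Rewc p q' sg C al th r c t s)); last exact: SubRewc.
  exists Ctl, (Rewc p q' sg C al th r c t s); split=> //.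
  exact: StRewcIn qq'.
- case: (step_stk qq' qv) => [|[v' [qv' st]]]; first by left.
  right; exists (mk (set_stack q' v')); last exact: SubStack.
  by exists b, (set_stack q' v').
Qed.

Let final_step X b k (q q' : state k) : step X b q q' -> ~ final (mk q).
Proof. by rewrite /final; case=> /= *; case. Qed.

Let sub1_final x y : simulates1 x y -> ~ final y.
Proof.
rewrite /final; case=> [*|*|k q v /=]; [by move=> /= []|by move=> /= []|].
by case=> b [s [[[|f w] [_ ->]]|[[|f w] [th [_ ->]]]|[_ ->]]]; case: q => *; case.
Qed.

Let sub_step x x' y : sub x y -> stepT x x' ->
  final x' \/ exists2 y', stepT y y' & sub x' y'.
Proof.
move=> xy; elim: xy x' => [{}x|{}x z {}y xz _ IH] x' xx'.
  by right; exists x' => //; apply: rt1n_refl.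
case: (sub1_step xz xx') => [|[z' zz' x'z']]; first by left.
right; case: (IH _ zz') => [/(sub1_final x'z')//|[y' yy' z'y']].
by exists y' => //; apply: rt1n_trans x'z' z'y'.
Qed.

Let good (x : T) : Prop :=
  forall b (q' : state (projT1 x)),
    step G b (projT2 x) q' -> step fails b (projT2 x) q'.

Let dominates (y : T) : Prop :=
  forall y', rtT y y' -> forall x, sub x y' -> good x.

Let good_run x y : dominates y -> sub x y -> forall x', rtT x x' -> good x'.
Proof.
move=> domy xy x' /(@Operators_Properties.clos_rt_rt1n _ _ _ _) xx'.
elim: xx' y domy xy => [{}x|{}x z {}x' xz zx' IH] y domy xy.
  exact: domy (rt_refl _ _ _) _ xy.
case: (sub_step xy xz) => [fz|[y' yy' zy']]; last first.
  apply: IH zy' => y'' y'y''; apply: domy; apply: rt_trans y'y''.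
  exact: rt_step.
have nstep X b q' : ~ step X b (projT2 z) q'.
  by case: z fz {xz zx' IH} q' => k q fq q' /final_step.
case: zx' => [b q' /nstep //|z1 x'' [b [q' [st _]]] _].
by case: (nstep _ _ _ st).
Qed.

Let fails_of_good k (t : cterms k) a th :
  (forall x, rtT (mk (At t [:: FStrat a; FSubst th])) x -> good x) ->
  G t a th -> fails t a th.
Proof.
set q0 := At t _ => good0 [acc0 sol0]; apply/fails_fix2.
have any (q q' : state k) : rtT (mk q0) (mk q) -> anystep G q q' ->
    anystep fails q q' /\ rtT (mk q0) (mk q').
  move=> qq [b /(good0 _ qq) st]; split; first by exists b.
  by apply: rt_trans qq (rt_step _ _ _ _ _); exists b, q'.
have run (q q' : state k) : clos_refl_trans_1n _ (@anystep G k) q q' ->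
    rtT (mk q0) (mk q) -> clos_refl_trans _ (@anystep fails k) q q'.
  elim=> [{}q _|{}q q1 {}q' qq1 _ IH q0q]; first exact: rt_refl.
  have [qq1' q0q1] := any _ _ q0q qq1.
  exact: rt_trans (rt_step _ _ _ _ qq1') (IH q0q1).
have acc (q : state k) : Acc (fun q' q => anystep fails q q') q ->
    rtT (mk q0) (mk q) -> Acc (fun q' q => anystep G q q') q.
  by elim=> {}q _ IH q0q; constructor=> q' /(any _ _ q0q)[/IH]; apply.
split; first by apply: acc => //; apply: rt_refl.
case=> t' /(@Operators_Properties.clos_rt_rt1n _ _ _ _) /run st; apply: sol0.
by exists t'; apply: st; apply: rt_refl.
Qed.

Let good_step y : (forall y', stepT y y' -> dominates y') ->
  forall x, sub x y -> good x.
Proof.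
move=> domy [k q] xy b q' /= st; elim: st xy => {k q b q'}; intros;
  try by econstructor; eauto.
- apply: StCondElse; apply: fails_of_good => // x.
  set q0 := At t _; set q1 := At t (FStrat a :: FStrat b :: s).
  have st1 : stepT (mk (At t (FStrat (Cond a b c) :: s))) (mk q1).
    by exists Ctl, q1; split=> //; apply: StCondThen.
  case: (sub_step xy st1) => // -[y' /domy domy' q1y'].
  apply: (good_run domy'); apply: rt1n_trans q1y'.
  apply: (@SubStack _ q0 (FStrat a :: FStrat b :: s)).
  by exists b, s; apply: Or31; exists [:: FStrat a].
- apply: StRewcIn; apply: H0; apply: rt1n_trans xy; exact: SubRewc.
- apply: StSubtermIn; apply: H0; apply: rt1n_trans xy; exact: SubSubterm.
Qed.

Let dominates_acc k (q : state k) :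
  Acc (fun q' q => anystep fails q q') q -> dominates (mk q).
Proof.
elim=> {}q _ IH y /(@Operators_Properties.clos_rt_rt1n _ _ _ _) qy.
have succ y' : stepT (mk q) y' -> dominates y'.
  by case=> b [q' [st ->]]; apply: IH; exists b.
case: qy => [|y1 {}y /succ domy1 /(@Operators_Properties.clos_rt1n_rt _ _ _ _)].
  exact: good_step.
exact: domy1.
Qed.

Lemma failsE k (t : cterms k) a th :
  fails t a th <-> finitely_fails fails t a th.
Proof.
split=> [/(_ (@finitely_fails fails)) lfp|ft].
  apply: lfp => k' t' a' th'; apply: finitely_fails_anti => k1 t1 a1 th1.
  by move/fails_fix2.
apply: (fails_of_good _ ft) => x q0x; case: ft => /dominates_acc dom0 _.
by apply: good_run dom0 _ _ q0x; apply: rt1n_refl.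
Qed.

End FailsFix.

Lemma fails_unique (X : oracle) :
  (forall k (t : cterms k) a th, X k t a th <-> finitely_fails X t a th) ->
  forall k (t : cterms k) a th, X k t a th <-> fails t a th.
Proof.
move=> fixX.
have sub k (t : cterms k) a th : fails t a th -> X k t a th.
  apply=> {}k {}t {}a {}th ft; apply/fixX; move: ft.
  by apply: finitely_fails_anti => k1 t1 a1 th1 /fixX.
move=> k t a th; split; last exact: sub.
by move=> /fixX ft; apply/failsE; move: ft; apply: finitely_fails_anti.
Qed.

End Strategies.

(** * Executions *)

Section Executions.
Variables (R : rewtheory) (SL : Type) (D : sdef R SL -> Prop).

(** [TE] is the set of ground terms modulo [E], and [XS] that of the execution
    states, of all kinds. *)
Definition TE := {k : kind R & cterms k}.
Definition XS := {k : kind R & state SL k}.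

Definition mkTE k (t : cterms k) : TE := existT _ k t.
Definition mkXS k (q : state SL k) : XS := existT _ k q.

Definition at_ (t : TE) (s : stack R SL) : XS := mkXS (At (projT2 t) s).

Definition current (q : XS) : TE := mkTE (cterm (projT2 q)).

Inductive rewTE : TE -> TE -> Prop :=
| RewTE k (t u : cterms k) : rew false t u -> rewTE (mkTE t) (mkTE u).

Inductive stepXS (b : stepkind) : XS -> XS -> Prop :=
| StepXS k (q q' : state SL k) :
    step D (fails D) b q q' -> stepXS b (mkXS q) (mkXS q').

Definition ctls : XS -> XS -> Prop := clos_refl_trans XS (stepXS Ctl).

(** The relation written as a two-headed arrow. *)
Definition sstep (q q' : XS) : Prop :=
  exists2 p, ctls q p & stepXS Sys p q'.

Definition Sol (q : XS) : Prop := ctls q (at_ (current q) [::]).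

(** [FinWord w0 w] is the non-empty finite word [w0 :: w]. *)
Inductive word (A : Type) :=
| FinWord (w0 : A) (w : seq A)
| InfWord (w : nat -> A).

Definition map_word A B (f : A -> B) (w : word A) : word B :=
  match w with
  | FinWord w0 w => FinWord (f w0) (map f w)
  | InfWord w => InfWord (f \o w)
  end.

(** Stuttering extension of the finite words. *)
Definition stutter A (w : word A) : nat -> A :=
  match w with
  | FinWord w0 w => nth (last w0 w) (w0 :: w)
  | InfWord w => w
  end.

Definition start (a : strat R SL) (t : TE) : XS := at_ t [:: FStrat a].

Definition Exfin (a : strat R SL) (t : TE) : set (word XS) :=
  [set w | exists q0 qs,
    [/\ w = FinWord q0 qs, q0 = start a t,
        forall i, i < size qs -> sstep (nth q0 (q0 :: qs) i) (nth q0 qs i) &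
        exists t' : TE, ctls (last q0 qs) (at_ t' [::])]].

Definition Exinf (a : strat R SL) (t : TE) : set (word XS) :=
  [set w | exists q,
    [/\ w = InfWord q, q 0 = start a t & forall i, sstep (q i) (q i.+1)]].

(** The denotation of [a] from [t]. *)
Definition denotation (a : strat R SL) (t : TE) : set (word TE) :=
  [set map_word current w | w in Exfin a t `|` Exinf a t].

End Executions.

(** * Kripke structures and linear-time properties *)

Record kripke (AP : Type) := Kripke {
  kstate : Type;
  kinit : set kstate;
  ktrans : kstate -> kstate -> Prop;
  klabel : kstate -> set AP
}.

Definition property (AP : Type) := set (nat -> set AP).

Definition satisfies AP (K : kripke AP) (phi : property AP) : Prop :=
  forall p : nat -> kstate K,
    kinit (p 0) -> (forall i, ktrans (p i) (p i.+1)) ->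
    phi (fun i => klabel (p i)).

(** Satisfaction by a set [F] of finite or infinite executions of [K]. *)
Definition satisfies_in AP (K : kripke AP) (F : set (word (kstate K)))
    (phi : property AP) : Prop :=
  forall w, F w -> phi (fun i => klabel (stutter w i)).

Section Models.
Variables (R : rewtheory) (SL AP : Type) (L : TE R -> set AP).

Definition rew_model : kripke AP := {|
  kstate := TE R;
  kinit := setT;
  ktrans := @rewTE R;
  klabel := L
|}.

Variables (D : sdef R SL -> Prop) (a : strat R SL) (t : TE R).

Inductive strat_trans : XS R SL * bool -> XS R SL * bool -> Prop :=
| STStep q q' : sstep D q q' -> strat_trans (q, false) (q', false)
| STEnd q b : Sol D q -> strat_trans (q, b) (q, true).

(** The Booleans [false] and [true] stand for 0 and 1. *)
Definition strat_model : kripke AP := {|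
  kstate := {x : XS R SL * bool | x.2 -> Sol D x.1};
  kinit := [set x | sval x = (start a t, false)];
  ktrans := fun x y => strat_trans (sval x) (sval y);
  klabel := fun x => L (current (sval x).1)
|}.

End Models.

(* Main.v *)
Require Import Defs.
From mathcomp Require Import all_boot.
From mathcomp Require Import boolp classical_sets.

(** Control steps preserve the current term.  The only step for which this is
    not immediate is [matchrew], which cuts a matched term into a pattern with
    slots, so filling these slots back has to give the original term.  Hence
    the solution reached by control steps alone from a state [q] is that of the
    current term of [q], and the last state of a finite execution lies in
    [Sol].  The runs of the model that enter the component 1 are then exactly
    the stuttering extensions of the finite executions, and the others are the
    infinite executions. *)

Set Implicit Arguments.
Unset Strict Implicit.
Unset Printing Implicit Defensive.

Section ControlSteps.
Variables (R : rewtheory) (SL : Type).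

(** The match on [P] abstracts over its kind index, so that inversion leaves no equalities between
    dependent pairs. *)
Lemma inst_inv (S : signature) (A : kind S -> Type)
    (opA : forall f : op S, (forall i, A (dom (f := f) i)) -> A (cod f))
    (g : forall k, nat -> A k -> Prop) k (P : pterm k) (a : A k) :
  inst opA g P a ->
  match P in term _ k return A k -> Prop with
  | Var k x => g k x
  | App f Q => fun a =>
      exists2 b, a = opA f b & forall i, inst opA g (Q i) (b i)
  end a.
Proof. by case=> // f Q b Qb; exists b. Qed.

(** At a variable of [P], a slot receives [ts i], its value under [sg], and any other leaf already
    holds that value. *)
Lemma fill_inst_but (sg : psubst R) n (xs : 'I_n -> kind R * nat) ts
    k (P : pterm k) (u : holeterm xs k) t :
  (forall i, sg (xs i).1 (xs i).2 = Some (ts i)) ->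
  inst_but sg P u -> qinst sg P t -> fill ts u = t.
Proof.
move=> sg_ts Pu; elim: Pu t => {k P u} [k x u xu|f P u _ IH] t Pt.
  move: (inst_inv Pt) => /=; rewrite /graph.
  case: xu t {Pt} => {k x u} [i _|k x v _ sgx] t.
    by rewrite sg_ts => -[].
  by rewrite sgx => -[].
case: (inst_inv Pt) => b -> Pb; congr (qapp _).
by apply: functional_extensionality_dep => i; apply: IH.
Qed.

Lemma fill_hplug n (xs : 'I_n -> kind R * nat)
    (ts : forall i, cterms (T := R) (xs i).1) k0 k (c : ctx k0 k)
    (u : holeterm xs k0) :
  fill ts (hplug c u) = plug c (fill ts u).
Proof.
elim: c => //= f a i c IH; congr (qapp _).
apply: functional_extensionality_dep => j.
by case: dfwithP => [|j' ij']; rewrite ?dfwith_in ?dfwith_out.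
Qed.

Lemma step_cterm (D : sdef R SL -> Prop) X k (q q' : state SL k) :
  step D X Ctl q q' -> cterm q' = cterm q.
Proof.
(* The step kind is generalized for the induction; the remembered equation discards the system
   steps. *)
move: {-1}Ctl (erefl Ctl) => b + st; elim: st => {b k q q'} //=.
- move=> k t m k0 P C n xs al s c sg ts u [_ _ _ [t0 Pt0 ->]] sg_ts Pu _.
  by rewrite fill_hplug (fill_inst_but sg_ts Pu Pt0).
- move=> b k n xs qs u s i q' _ IH bE; congr (fill _ u).
  apply: functional_extensionality_dep => j.
  by case: dfwithP => [|//]; apply: IH.
- move=> k n xs qs u s ts qs_ts _; congr (fill _ u).
  by apply: functional_extensionality_dep => i; rewrite qs_ts.
Qed.

Lemma ctls_current (D : sdef R SL -> Prop) q q' :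
  ctls D q q' -> current q' = current q.
Proof.
elim=> {q q'} [_ _ [k q q' /step_cterm]|//|q p q' _ pq _ q'p].
  by rewrite /current /mkTE /= => ->.
by rewrite q'p.
Qed.

Lemma SolP (D : sdef R SL -> Prop) q :
  Sol D q <-> exists t, ctls D q (at_ t [::]).
Proof.
split=> [|[[k t] qt]]; first by exists (current q).
by rewrite /Sol -(ctls_current qt).
Qed.

End ControlSteps.

Lemma stutter_map A B (f : A -> B) (w : word A) i :
  stutter (map_word f w) i = f (stutter w i).
Proof.
case: w => //= w0 w; rewrite last_map -map_cons.
have [iw|wi] := ltnP i (size (w0 :: w)).
  by rewrite (nth_map (last w0 w)).
by rewrite !nth_default ?size_map.
Qed.

(** The list is the prefix [q 0, ..., q n], with its head apart as [FinWord] requires. *)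
Lemma nth_cons_mkseq A (q : nat -> A) x n i :
  i <= n -> nth x (q 0 :: mkseq (q \o S) n) i = q i.
Proof. by case: i => //= i i_n; rewrite nth_mkseq. Qed.

Lemma last_mkseq A (q : nat -> A) n : last (q 0) (mkseq (q \o S) n) = q n.
Proof. by rewrite (last_nth (q 0)) size_mkseq nth_cons_mkseq. Qed.

Lemma stutter_mkseq A (q : nat -> A) n i :
  stutter (FinWord (q 0) (mkseq (q \o S) n)) i = q (minn i n).
Proof.
rewrite /stutter last_mkseq; have [i_n|n_i] := leqP i n.
  by rewrite nth_cons_mkseq.
by rewrite nth_default //= size_mkseq.
Qed.

Section Runs.
Variables (R : rewtheory) (SL AP : Type) (L : TE R -> set AP).
Variables (D : sdef R SL -> Prop) (a : strat R SL) (t : TE R).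

Local Notation M := (strat_model L D a t).

(** The Boolean of the target tells the constructors apart: [STEnd] gives [true], [STStep] gives
    [false]. *)
Lemma strat_transE x y :
  strat_trans D x y <->
  if y.2 then Sol D x.1 /\ y.1 = x.1 else x.2 = false /\ sstep D x.1 y.1.
Proof.
split=> [[]//|]; case: x y => [q b] [q' []] /= [].
- by move=> Dq ->; apply: STEnd.
- by move=> ->; apply: STStep.
Qed.

Lemma run_word (p : nat -> kstate M) :
  kinit (p 0) -> (forall i, ktrans (p i) (p i.+1)) ->
  exists2 w, (Exfin D a t `|` Exinf D a t)%classic w &
    forall i, (sval (p i)).1 = stutter w i.
Proof.
move=> p0 pS; pose q i := (sval (p i)).1; pose b i := (sval (p i)).2.
have q0 : q 0 = start a t by rewrite /q p0.
have {pS} qS i : if b i.+1 then Sol D (q i) /\ q i.+1 = q i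
                 else b i = false /\ sstep D (q i) (q i.+1).
  exact/strat_transE/pS.
have [b_ex|b_none] := pselect (exists i, b i); last first.
  exists (InfWord q) => //; right; exists q; split=> // i.
  by move: (qS i); case: ifP => [bi|_ []//]; case: b_none; exists i.+1.
(* The run starts in component 0, so its first index in component 1 is a successor [n.+1]; the
   finite execution is [q 0, ..., q n]. *)
have [[|n] bn minb] := find_ex_minn b_ex.
  by move: bn; rewrite /b p0.
have qlt i : i < n -> sstep D (q i) (q i.+1).
  move=> i_n; move: (qS i); case: ifP => [/minb|_ []//].
  by rewrite ltnS leqNgt i_n.
have bge j : b (n.+1 + j).
  elim: j => [|j IH]; rewrite ?addn0 // addnS.
  by move: (qS (n.+1 + j)); case: ifP => // _ []; rewrite IH.
(* Constant from [n], not only from [n.+1]: the step that enters component 1 keeps the state too. *)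
have qge j : q (n + j) = q n.
  elim: j => [|j IH]; rewrite ?addn0 // addnS.
  by move: (qS (n + j)); rewrite -addSn bge IH => -[].
exists (FinWord (q 0) (mkseq (q \o S) n)) => [|i]; last first.
  rewrite stutter_mkseq -/(q i); have [//|n_i] := leqP i n.
  by rewrite -(subnKC (ltnW n_i)) qge.
left; exists (q 0), (mkseq (q \o S) n); split=> // [i|].
  rewrite size_mkseq => i_n.
  by rewrite (nth_cons_mkseq _ _ (ltnW i_n)) nth_mkseq //; apply: qlt.
(* The step from [n] enters component 1, so its source [q n] is in [Sol]. *)
by rewrite last_mkseq; apply/SolP; move: (qS n); rewrite bn => -[].
Qed.

Lemma word_run w : (Exfin D a t `|` Exinf D a t)%classic w ->
  exists p : nat -> kstate M,
    [/\ kinit (p 0), forall i, ktrans (p i) (p i.+1) &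
        forall i, (sval (p i)).1 = stutter w i].
Proof.
case=> [[q0 [qs [-> q0E qsS /SolP q_sol]]]|[q [-> q0E qS]]]; last first.
  have q_sol i : false -> Sol D (q i) by [].
  exists (fun i => exist (fun x : XS R SL * bool => x.2 -> Sol D x.1)
                         (q i, false) (@q_sol i)).
  by split=> //= [|i]; [rewrite q0E|apply: STStep].
pose v := FinWord q0 qs.
have v_last i : size qs <= i -> stutter v i = last q0 qs.
  rewrite leq_eqVlt => /predU1P[<-|qs_i]; last by rewrite /= nth_default.
  by rewrite /= -[size qs]/(size (q0 :: qs)).-1 nth_last.
have v_sol i : size qs <= i -> Sol D (stutter v i) by move=> /v_last->.
(* The last letter, at index [size qs], is first visited in component 0; every later index repeats
   it in component 1. *)
exists (fun i => exist (fun x : XS R SL * bool => x.2 -> Sol D x.1)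
                       (stutter v i, size qs < i)
                       (fun qs_i => v_sol i (ltnW qs_i))).
split=> //= [|i]; first by rewrite q0E.
apply/strat_transE => /=; rewrite ltnS.
have [qs_i|i_qs] := leqP (size qs) i.
  split; first exact: v_sol.
  exact: etrans (v_last _ (leqW qs_i)) (esym (v_last _ qs_i)).
rewrite ltnNge (ltnW i_qs); split=> //.
(* [Exfin] reads letters with default [q0] and [stutter] with the last letter; the indices are in
   range, so both agree. *)
have := qsS i i_qs; rewrite (set_nth_default (last q0 qs) q0) ?leqW //.
by rewrite (set_nth_default (last q0 qs) q0).
Qed.

End Runs.

Theorem corollary1 (R : rewtheory) (SL : Type) (D : sdef R SL -> Prop)
    (AP : Type) (L : TE R -> set AP) (alpha : strat R SL)
    (k : kind R) (t : @gterm R k) (phi : property AP) :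
  satisfies_in (K := rew_model L) (denotation D alpha (mkTE (class t))) phi <->
  satisfies (strat_model L D alpha (mkTE (class t))) phi.
Proof.
split=> [sat p p0 pS|sat _ [w w_run <-]].
  have [w w_run pw] := run_word p0 pS.
  have := sat (map_word (@current R SL) w) (ex_intro2 _ _ w w_run erefl).
  (* [phi] is a set of functions: the labels agree letter by letter, and extensionality makes the
     traces equal. *)
  by congr phi; apply: funext => i; rewrite /= stutter_map pw.
have [p [p0 pS pw]] := word_run L w_run.
have := sat p p0 pS.
by congr phi; apply: funext => i; rewrite /= stutter_map pw.
Qed.
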